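(* Let $m$ be an even positive integer, $n$ a positive integer, and let $\mathcal{C}$ be an order $m$ dimension $n$ symmetric Cauchy tensor with generating vector $c=(c_1,\ldots,c_n)\in\mathbb{R}^n$. Suppose $c_i>0$ for all $i\in[n]$ and at least two entries of $c$ are different. Let $\lambda_{\max}$ be the largest H-eigenvalue of $\mathcal{C}$, let $\bar a=\max_{1\le i\le n}c_i$, and let $$r_i=\sum_{i_2,\ldots,i_m\in[n]}\frac{1}{c_i+c_{i_2}+\cdots+c_{i_m}}\ (i\in[n]),\qquad R=\max_{1\le i\le n}r_i,\qquad r=\min_{1\le i\le n}r_i.$$ Then $$r+\frac{1}{m\bar a}\left(\sqrt{\frac{R}{r}}-1\right)<\lambda_{\max}<R-\frac{1}{m\bar a}\left(1-\sqrt{\frac{r}{R}}\right).$$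
   Context: $[n]=\{1,\ldots,n\}$. An order $m$ dimension $n$ symmetric Cauchy tensor with generating vector $c=(c_1,\ldots,c_n)\in\mathbb{R}^n$ is the real tensor $\mathcal{C}=(c_{i_1\cdots i_m})$ with entries $c_{i_1i_2\cdots i_m}=\frac{1}{c_{i_1}+c_{i_2}+\cdots+c_{i_m}}$, $i_1,\ldots,i_m\in[n]$, where it is assumed that $c_{i_1}+\cdots+c_{i_m}\neq 0$ for all $i_1,\ldots,i_m\in[n]$. For a real symmetric tensor $\mathcal{T}=(t_{i_1\cdots i_m})$ of order $m$ and dimension $n$, $\lambda\in\mathbb{R}$ is an H-eigenvalue of $\mathcal{T}$ if there is a nonzero $x\in\mathbb{R}^n$ with $\mathcal{T}x^{m-1}=\lambda x^{[m-1]}$, i.e. $\sum_{i_2,\ldots,i_m\in[n]}t_{ii_2\cdots i_m}x_{i_2}\cdots x_{i_m}=\lambda x_i^{m-1}$ for all $i\in[n]$. (Even order real symmetric tensors always have H-eigenvalues.) *)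

(* Defs.v *)
From HB Require Import structures.
From mathcomp Require Import all_boot all_order all_algebra.
From mathcomp Require Import reals.

Set Implicit Arguments.
Unset Strict Implicit.
Unset Printing Implicit Defensive.

Import Order.TTheory GRing.Theory Num.Theory.
Local Open Scope ring_scope.

(* A tensor of order m and dimension n is given by its entries; the multi-index
   (i_1, ..., i_m) is an m-tuple over 'I_n (indices are 0-based). *)
Definition tensor (R : realType) (m n : nat) := m.-tuple 'I_n -> R.

Definition index_sum (R : realType) (n : nat) (c : 'rV[R]_n) (s : seq 'I_n) : R :=
  \sum_(j <- s) c ord0 j.

Definition symmetric_Cauchy_tensor (R : realType) (m n : nat)
    (c : 'rV[R]_n) (C : tensor R m n) : Prop :=
  (forall s : m.-tuple 'I_n, index_sum c s != 0) /\
  (forall s : m.-tuple 'I_n, C s = 1 / index_sum c s).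

(* (T x^{m-1})_i : the sum ranges over the multi-indices whose first component
   is i, and the product over the remaining m-1 components. *)
Definition tensor_apply (R : realType) (m n : nat)
    (T : tensor R m n) (x : 'rV[R]_n) (i : 'I_n) : R :=
  \sum_(s : m.-tuple 'I_n | ohead s == Some i)
     T s * \prod_(j <- behead s) x ord0 j.

Definition H_eigenvalue (R : realType) (m n : nat)
    (T : tensor R m n) (lam : R) : Prop :=
  exists x : 'rV[R]_n, x != 0 /\
    forall i : 'I_n, tensor_apply T x i = lam * x ord0 i ^+ m.-1.

Definition largest_H_eigenvalue (R : realType) (m n : nat)
    (T : tensor R m n) (lam : R) : Prop :=
  H_eigenvalue T lam /\ forall mu : R, H_eigenvalue T mu -> mu <= lam.

Definition Cauchy_row_sum (R : realType) (m n : nat)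
    (c : 'rV[R]_n) (i : 'I_n) : R :=
  \sum_(s : m.-1.-tuple 'I_n) 1 / (c ord0 i + index_sum c s).

(* Seeding the iteration with the value at index 0 (available since 0 < n)
   makes these the true maximum and minimum of f, whatever its signs. *)
Definition max_entry (R : realType) (n : nat) (n_gt0 : (0 < n)%N)
    (f : 'I_n -> R) : R :=
  \big[Num.max/f (Ordinal n_gt0)]_(i < n) f i.

Definition min_entry (R : realType) (n : nat) (n_gt0 : (0 < n)%N)
    (f : 'I_n -> R) : R :=
  \big[Num.min/f (Ordinal n_gt0)]_(i < n) f i.

(* Main.v *)
Require Import Defs.
From HB Require Import structures.
From mathcomp Require Import all_boot all_order all_algebra.
From mathcomp Require Import reals.
From mathcomp Require Import boolp classical_sets topology normedtype.
From mathcomp Require Import derive realfun.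
From mathcomp Require Import lra.

Set Implicit Arguments.
Unset Strict Implicit.
Unset Printing Implicit Defensive.

Import Order.TTheory GRing.Theory Num.Theory.
Import numFieldNormedType.Exports.
Local Open Scope ring_scope.

(** Call lam a sub-eigenvalue if lam x_i^(m-1) <= (C x^(m-1))_i for some nonzero
   x >= 0.  By compactness there is a largest one; if some row were strict,
   raising that coordinate slightly would make every row strict, since C is
   positive, and lam could be increased.  So the largest sub-eigenvalue has a
   positive eigenvector.  The absolute value of any eigenvector shows that it
   is lambda_max.

   Let x > 0 be this eigenvector, with P and Q the (m-1)-st powers of its
   largest and smallest entries, and kap = 1/(m abar), a lower bound for the
   entries of C.  Isolating one entry of a row gives
     lambda_max P <= R P - kap (P - Q)  and  r Q + kap (P - Q) <= lambda_max Q.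
   The rows attaining R and r give R Q <= lambda_max P and
   lambda_max Q <= r P - kap (P - Q), whence R Q^2 < r P^2, that is
   Q / P < sqrt (r / R). *)

(** * Extrema of finite families *)

Lemma le_max_entry (R : realType) (n : nat) (n_gt0 : (0 < n)%N)
    (f : 'I_n -> R) (i : 'I_n) : f i <= max_entry n_gt0 f.
Proof. exact: le_bigmax. Qed.

Lemma max_entry_attained (R : realType) (n : nat) (n_gt0 : (0 < n)%N)
    (f : 'I_n -> R) : exists i, max_entry n_gt0 f = f i.
Proof.
rewrite /max_entry; elim/big_ind: _ => [|x y [i ->] [j ->]|i _].
- by exists (Ordinal n_gt0).
- by rewrite /Num.max; case: ifP => _; [exists j|exists i].
- by exists i.
Qed.

Lemma min_entry_le (R : realType) (n : nat) (n_gt0 : (0 < n)%N)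
    (f : 'I_n -> R) (i : 'I_n) : min_entry n_gt0 f <= f i.
Proof. exact: bigmin_le. Qed.

Lemma min_entry_attained (R : realType) (n : nat) (n_gt0 : (0 < n)%N)
    (f : 'I_n -> R) : exists i, min_entry n_gt0 f = f i.
Proof.
rewrite /min_entry; elim/big_ind: _ => [|x y [i ->] [j ->]|i _].
- by exists (Ordinal n_gt0).
- by rewrite /Num.min; case: ifP => _; [exists i|exists j].
- by exists i.
Qed.

Lemma cvg_expr (R : realType) (T : Type) (F : set_system T) (FF : Filter F)
    (f : T -> R) (l : R) (k : nat) :
  (f @ F --> l -> (fun t => f t ^+ k) @ F --> l ^+ k)%classic.
Proof.
move=> fl; elim: k => [|k IHk]; first exact: cvg_cst.
under eq_fun do rewrite exprS.
by rewrite exprS; exact: cvgM.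
Qed.

(** * Homogeneous forms with positive coefficients *)

Section PositiveRowForm.
Context (R : realType) (n k : nat).
Implicit Types (x y : 'I_n -> R) (i j p q : 'I_n) (s : k.-tuple 'I_n).

(** Here [k] stands for m - 1 and [a i s] for the entry with first index [i] and remaining indices
    [s]. Splitting off the first index makes the row sums plain sums over [s]. *)
Definition row_form (a : 'I_n -> k.-tuple 'I_n -> R) x i : R :=
  \sum_(s : k.-tuple 'I_n) a i s * \prod_(j <- s) x j.

Context (a : 'I_n -> k.-tuple 'I_n -> R).
Hypothesis a_gt0 : forall i s, 0 < a i s.

Let prod_ge0 x (s : seq 'I_n) :
  (forall i, 0 <= x i) -> 0 <= \prod_(j <- s) x j.
Proof. by move=> x_ge0; apply: prodr_ge0. Qed.

Lemma ler_prod_tuple x y s : (forall i, 0 <= x i <= y i) ->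
  \prod_(j <- s) x j <= \prod_(j <- s) y j.
Proof. by move=> xy; apply: ler_prod. Qed.

Lemma prod_tuple_const (t : R) s : \prod_(j <- s) t = t ^+ k.
Proof. by rewrite big_const_seq count_predT size_tuple iter_mulr_1. Qed.

Lemma prod_nseq_tuple x q : \prod_(j <- nseq_tuple k q) x j = x q ^+ k.
Proof. by rewrite big_nseq iter_mulr_1. Qed.

Lemma row_form_ge0 x i : (forall i, 0 <= x i) -> 0 <= row_form a x i.
Proof.
move=> x_ge0; apply: sumr_ge0 => s _.
by rewrite mulr_ge0 ?prod_ge0 // ltW.
Qed.

Lemma row_form_gt0 x i p :
  (forall i, 0 <= x i) -> 0 < x p -> 0 < row_form a x i.
Proof.
move=> x_ge0 xp; rewrite /row_form (bigD1 (nseq_tuple k p)) //=.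
rewrite ltr_wpDr ?sumr_ge0 // => [s _|].
  by rewrite mulr_ge0 ?prod_ge0 // ltW.
by rewrite (prod_nseq_tuple x) mulr_gt0 // exprn_gt0.
Qed.

Lemma row_form_homog (t : R) x i :
  row_form a (fun j => t * x j) i = t ^+ k * row_form a x i.
Proof.
rewrite /row_form mulr_sumr; apply: eq_bigr => s _.
by rewrite big_split /= prod_tuple_const mulrCA.
Qed.

Lemma ler_norm_row_form x i :
  `|row_form a x i| <= row_form a (fun j => `|x j|) i.
Proof.
apply: le_trans (ler_norm_sum _ _ _) _; apply: ler_sum => s _.
by rewrite normrM normr_prod gtr0_norm.
Qed.

(** No monomial decreases, and the pure power of coordinate [p], whose coefficient is positive,
    strictly increases. *)
Lemma row_form_lt x y i p : (0 < k)%N -> (forall i, 0 <= x i <= y i) ->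
  x p < y p -> row_form a x i < row_form a y i.
Proof.
move=> k_gt0 xy xyp.
have x_ge0 j : 0 <= x j by case/andP: (xy j).
rewrite /row_form (bigD1 (nseq_tuple k p)) //=.
rewrite [ltRHS](bigD1 (nseq_tuple k p)) //=.
apply: ltr_leD; last first.
  by apply: ler_sum => s _; rewrite ler_pM2l // ler_prod_tuple.
rewrite (prod_nseq_tuple x) (prod_nseq_tuple y) ltr_pM2l //.
by rewrite ltrXn2r ?x_ge0 // -lt0n k_gt0.
Qed.

(** The monomial of [(q, ..., q)] is kept exact and every other one is bounded by [x p ^+ k]. The
    gain is largest when [x q] is the smallest coordinate. *)
Lemma row_form_le_max x i p q : (forall j, 0 <= x j <= x p) ->
  row_form a x i <= (\sum_s a i s) * x p ^+ k
    - a i (nseq_tuple k q) * (x p ^+ k - x q ^+ k).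
Proof.
move=> xp; rewrite /row_form (bigD1 (nseq_tuple k q)) //= (prod_nseq_tuple x).
rewrite [\sum_s a i s](bigD1 (nseq_tuple k q)) //=.
rewrite mulrBr mulrDl addrAC opprB addrCA subrr addr0 lerD2l mulr_suml.
apply: ler_sum => s _; rewrite ler_pM2l // -(prod_tuple_const _ s).
exact: ler_prod_tuple.
Qed.

(** Dually, only the monomial of [(p, ..., p)] is kept exact and the others are bounded below by
    [x q ^+ k]. *)
Lemma row_form_ge_min x i p q : 0 <= x q -> (forall j, x q <= x j) ->
  (\sum_s a i s) * x q ^+ k
    + a i (nseq_tuple k p) * (x p ^+ k - x q ^+ k) <= row_form a x i.
Proof.
move=> xq_ge0 xq.
rewrite /row_form [leRHS](bigD1 (nseq_tuple k p)) //= (prod_nseq_tuple x).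
rewrite [\sum_s a i s](bigD1 (nseq_tuple k p)) //=.
rewrite mulrBr mulrDl addrAC (addrC (_ * x q ^+ k)) subrK lerD2l mulr_suml.
apply: ler_sum => s _; rewrite ler_pM2l // -(prod_tuple_const _ s).
by apply: ler_prod_tuple => j; rewrite xq_ge0 xq.
Qed.

(** * Sub-eigenvalues and the positive eigenvector *)

Definition sub_eigen (lam : R) x :=
  [/\ forall i, 0 <= x i, exists i, 0 < x i &
      forall i, lam * x i ^+ k <= row_form a x i].

(** The row of a largest coordinate bounds [lam] by its row sum. The sum of all entries serves as a
    bound independent of [x], which compactness requires. *)
Lemma sub_eigen_bound lam x :
  sub_eigen lam x -> lam <= \sum_i \sum_s a i s.
Proof.
case=> x_ge0 [i0 xi0] lamx.
pose p := [arg max_(i > i0) x i]%O.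
have xp j : x j <= x p by rewrite /p; case: arg_maxP => // i _; apply.
have xp_gt0 : 0 < x p by apply: lt_le_trans (xp i0).
have : lam * x p ^+ k <= (\sum_s a p s) * x p ^+ k.
  apply: le_trans (lamx p) _.
  have := @row_form_le_max x p p p; rewrite subrr mulr0 subr0; apply=> j.
  by rewrite x_ge0 xp.
rewrite ler_pM2r ?exprn_gt0 // => /le_trans; apply.
rewrite [leRHS](bigD1 p) //= lerDl; apply: sumr_ge0 => i _.
by apply: sumr_ge0 => s _; apply: ltW.
Qed.

Local Open Scope classical_set_scope.
Local Open Scope ring_scope.

(* Raising coordinate i keeps row i strict if the increment is small, and makes
   every other row strict because a j (i, ..., i) > 0. *)
Lemma sub_eigen_improve (lam : R) x i : (0 < k)%N -> 0 <= lam ->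
  sub_eigen lam x -> lam * x i ^+ k < row_form a x i ->
  exists2 mu : R, lam < mu & exists y, sub_eigen mu y.
Proof.
move=> k_gt0 lam_ge0 [x_ge0 [i0 xi0] lamx] lt_i.
have [e e_gt0 lte] : exists2 e : R, 0 < e &
    lam * (x i + e) ^+ k < row_form a x i.
  have cv : (fun e : R => lam * (x i + e) ^+ k) e @[e --> 0^'+]
      --> lam * (x i + 0) ^+ k.
    apply: cvg_at_right_filter.
    apply: cvgM; first exact: cvg_cst.
    by apply: cvg_expr; apply: cvgD; [exact: cvg_cst|exact: cvg_id].
  rewrite addr0 in cv.
  suff [e [? ?]] : exists e : R, 0 < e /\ lam * (x i + e) ^+ k < row_form a x i.
    by exists e.
  apply: (@filter_ex _ (0^'+)); apply: filterI; first exact: nbhs_right_gt.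
  exact: cvgr_lt cv _ lt_i.
pose y j := if j == i then x j + e else x j.
have xy j : 0 <= x j <= y j.
  by rewrite x_ge0 /y; case: eqP => //= _; rewrite lerDl ltW.
have ltA j : row_form a x j < row_form a y j.
  by apply: (@row_form_lt x y j i) => //; rewrite /y eqxx ltrDl.
have lty j : lam * y j ^+ k < row_form a y j.
  apply: le_lt_trans _ (ltA j); rewrite {1}/y.
  by case: eqP => [->|_]; [exact: ltW|exact: lamx].
(* Finitely many strict inequalities, each stable under a small increase of [lam], admit a common
   [mu]. *)
have [mu [mu_gt muy]] : exists mu : R, lam < mu /\
    forall j, mu * y j ^+ k < row_form a y j.
  have near_row : \forall mu \near lam^'+, forall j,
      mu * y j ^+ k < row_form a y j.
    apply: filter_forall => j.
    suff cv : (fun mu => mu * y j ^+ k) mu @[mu --> lam^'+]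
        --> lam * y j ^+ k by exact: cvgr_lt cv _ (lty j).
    apply: cvg_at_right_filter.
    by apply: cvgM; [exact: cvg_id|exact: cvg_cst].
  exact: (@filter_ex R (lam^'+) _ _ (filterI (nbhs_right_gt lam) near_row)).
exists mu => //; exists y; split=> [j||j].
- by case/andP: (xy j) => /le_trans; apply.
- by exists i0; apply: lt_le_trans xi0 _; case/andP: (xy i0).
- exact/ltW/muy.
Qed.

Lemma continuous_row_form i : continuous (fun v : 'rV[R]_n => row_form a (v ord0) i).
Proof.
have add_cont : continuous (fun z : R * R => z.1 + z.2).
  by move=> z; apply: cvgD; [exact: cvg_fst|exact: cvg_snd].
have mul_cont : continuous (fun z : R * R => z.1 * z.2).
  by move=> z; apply: cvgM; [exact: cvg_fst|exact: cvg_snd].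
apply: (continuous_big add_cont) => s _.
have prod_cont : continuous (fun v : 'rV[R]_n => \prod_(j <- s) v ord0 j).
  by apply: (continuous_big mul_cont) => j _; exact: coord_continuous.
by move=> v; apply: continuousM; [exact: cst_continuous|exact: prod_cont].
Qed.

(** Up to rescaling [x], the sub-eigenpairs with nonnegative first component form a compact set [A],
    on which the projection to that component attains its maximum. *)
Lemma sub_eigen_max : (0 < n)%N -> exists2 lam : R, 0 <= lam &
  (exists x, sub_eigen lam x) /\
  (forall mu y, 0 <= mu -> sub_eigen mu y -> mu <= lam).
Proof.
move=> n_gt0; pose B := \sum_i \sum_s a i s.
pose box : set (R * 'rV[R]_n) :=
  `[0, B]%classic `*` [set v : 'rV[R]_n | forall i, v ord0 i \in `[0, 1]].
pose A := box `&` ((fun z : R * 'rV[R]_n => \sum_i z.2 ord0 i) @^-1` [set t | 1 <= t] `&`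
  \bigcap_(i in [set: 'I_n])
    ((fun z : R * 'rV[R]_n => row_form a (z.2 ord0) i - z.1 * z.2 ord0 i ^+ k)
      @^-1` [set t | 0 <= t])).
(* With coordinates in [0, 1], the condition 1 <= sum keeps x away from 0. *)
have sub_of_A z : A z -> sub_eigen z.1 (z.2 ord0).
  case=> -[_ zbox] [/= zsum zrow]; split=> [i||i].
  - by have := zbox i; rewrite /= in_itv /= => /andP[].
  - apply: contrapT => /forallNP zn.
    have : \sum_i z.2 ord0 i <= 0.
      by apply: sumr_le0 => i _; rewrite leNgt; apply/negP/zn.
    by apply/negP; rewrite -ltNge (lt_le_trans ltr01).
  - by have := zrow i I; rewrite /= subr_ge0.
have A_of_sub mu y : 0 <= mu -> sub_eigen mu y -> exists v, A (mu, v).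
  move=> mu_ge0 suby; have muB := sub_eigen_bound suby.
  case: suby => y_ge0 [i0 yi0] muy.
  pose p := [arg max_(i > i0) y i]%O.
  have yp j : y j <= y p by rewrite /p; case: arg_maxP => // i _; apply.
  have yp_gt0 : 0 < y p by apply: lt_le_trans (yp i0).
  (* Dividing by the largest coordinate puts all coordinates in [0, 1] and makes coordinate [p]
     equal to 1, so the sum is at least 1. Homogeneity preserves the row inequalities. *)
  pose v : 'rV[R]_n := \row_j ((y p)^-1 * y j).
  have vE j : v ord0 j = (y p)^-1 * y j by rewrite mxE.
  have v_ge0 j : 0 <= v ord0 j by rewrite vE mulr_ge0 // invr_ge0 ltW.
  exists v; split; [split|split] => /=.
  - by rewrite in_itv /= mu_ge0.
  - by move=> j; rewrite /= in_itv /= v_ge0 vE (mulrC _ (y j)) ler_pdivrMr ?mul1r ?yp.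
  - rewrite (bigD1 p) //= vE mulVf ?gt_eqF // lerDl.
    by apply: sumr_ge0.
  - move=> j _ /=; rewrite subr_ge0.
    have -> : row_form a (v ord0) j = (y p)^-1 ^+ k * row_form a y j.
      by rewrite -row_form_homog; congr row_form; apply/funext => l.
    rewrite vE exprMn mulrCA ler_pM2l //.
    by rewrite exprn_gt0 // invr_gt0.
have A_compact : compact A.
  apply: compact_closedI.
    apply: compact_setX; first exact: segment_compact.
    exact: (@rV_compact R n (fun=> `[0 : R, 1]%classic)
      (fun=> @segment_compact R 0 1)).
  have coord j : continuous (fun z : R * 'rV[R]_n => z.2 ord0 j).
    move=> z; apply: (@cvg_comp _ _ _ snd (fun v : 'rV[R]_n => v ord0 j)).
      exact: cvg_snd.
    exact: coord_continuous.
  apply: closedI.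
    apply: preimage_closed; last exact: closed_ge.
    move=> z _; apply: (@continuous_big _ _ +%R) => //.
    by move=> w; apply: cvgD; [exact: cvg_fst|exact: cvg_snd].
  apply: closed_bigI => j _.
  apply: preimage_closed; last exact: closed_ge.
  move=> z _; apply: cvgB.
    apply: (@cvg_comp _ _ _ snd (fun v : 'rV[R]_n => row_form a (v ord0) j)).
      exact: cvg_snd.
    exact: continuous_row_form.
  apply: cvgM; first exact: cvg_fst.
  by apply: cvg_expr; exact: coord.
have A_neq0 : A !=set0.
  (* The all-ones vector is a sub-eigenvector for 0. *)
  have [|v Av] := @A_of_sub 0 (fun=> 1) (lexx 0); last by exists (0, v).
  split=> [i||i]; first exact: ler01.
    by exists (Ordinal n_gt0); exact: ltr01.
  by rewrite mul0r row_form_ge0.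
have [|z zA zmax] := @compact_EVT_max _ R fst A A_neq0 A_compact.
  by apply: continuous_subspaceT => z; exact: cvg_fst.
have {}zA : A z by rewrite inE in zA.
exists z.1; first by case: zA => -[]; rewrite /= in_itv /= => /andP[].
split; first by exists (z.2 ord0); apply: sub_of_A.
move=> mu y mu_ge0 /(A_of_sub _ _ mu_ge0)[v Av].
by apply: (zmax (mu, v)); rewrite inE.
Qed.

Lemma largest_eigenvector lam : (0 < n)%N -> (0 < k)%N ->
  (exists2 x, exists i, x i != 0 & forall i, row_form a x i = lam * x i ^+ k) ->
  (forall mu x, (exists i, x i != 0) ->
     (forall i, row_form a x i = mu * x i ^+ k) -> mu <= lam) ->
  exists2 y, forall i, 0 < y i & forall i, row_form a y i = lam * y i ^+ k.
Proof.
move=> n_gt0 k_gt0 [x [i0 xi0] xP] lam_max.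
have [lam0 lam0_ge0 [[y suby] lam0_max]] := sub_eigen_max n_gt0.
(* A strict row would allow a sub-eigenvalue larger than the maximum [lam0]. *)
have yP i : row_form a y i = lam0 * y i ^+ k.
  apply: le_anti; case: (suby) => _ _ -> //; rewrite andbT leNgt; apply/negP.
  move=> /(sub_eigen_improve k_gt0 lam0_ge0 suby)[mu lt_mu [z subz]].
  have := lam0_max mu z (le_trans lam0_ge0 (ltW lt_mu)) subz.
  by rewrite leNgt lt_mu.
case: (suby) => y_ge0 [j yj] _.
have le_lam0 : lam0 <= lam.
  by apply: (lam_max _ y) => //; exists j; rewrite gt_eqF.
have lam_ge0 := le_trans lam0_ge0 le_lam0.
have lamE : lam = lam0.
  apply: le_anti; rewrite le_lam0 andbT.
  (* By the triangle inequality and [lam >= 0], the vector of absolute values of [x] is a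
     sub-eigenvector for [lam]. *)
  apply: (lam0_max _ (fun i => `|x i|)) => //; split=> // [|i].
    by exists i0; rewrite normr_gt0.
  apply: le_trans (ler_norm_row_form x i).
  by rewrite xP normrM normrX ger0_norm.
exists y => i; last by rewrite lamE.
(* A zero coordinate would make the right-hand side vanish, as [0 < k], whereas the row form is
   positive. *)
rewrite lt0r y_ge0 andbT; have := row_form_gt0 i y_ge0 yj; rewrite yP.
by apply: contraTneq => ->; rewrite expr0n -[k == 0]negbK -lt0n k_gt0 mulr0 ltxx.
Qed.

(** * Two-sided bounds from a positive eigenvector *)

Lemma eigenvalue_bounds (lam rmin rmax kap : R) y : (0 < n)%N ->
  (forall i, 0 < y i) -> (forall i, row_form a y i = lam * y i ^+ k) ->
  0 < kap -> (forall i s, kap <= a i s) ->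
  (forall i, rmin <= \sum_s a i s <= rmax) ->
  (exists i, rmin = \sum_s a i s) -> (exists i, rmax = \sum_s a i s) ->
  rmin < rmax ->
  rmin + kap * (Num.sqrt (rmax / rmin) - 1) < lam /\
  lam < rmax - kap * (1 - Num.sqrt (rmin / rmax)).
Proof.
move=> n_gt0 y_gt0 yP kap_gt0 kap_le r_bounds [imin rminE] [imax rmaxE] rltR.
pose i0 := Ordinal n_gt0.
pose p := [arg max_(i > i0) y i]%O; pose q := [arg min_(i < i0) y i]%O.
have yp j : y j <= y p by rewrite /p; case: arg_maxP => // i _; apply.
have yq j : y q <= y j by rewrite /q; case: arg_minP => // i _; apply.
have y_ge0 i : 0 <= y i by apply: ltW.
have y_in i : 0 <= y i <= y p by rewrite y_ge0 yp.
set P := y p ^+ k; set Q := y q ^+ k.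
have Q_gt0 : 0 < Q by apply: exprn_gt0.
have QP : Q <= P by apply: lerXn2r; rewrite ?nnegrE.
have P_gt0 := lt_le_trans Q_gt0 QP.
have rmin_gt0 : 0 < rmin.
  rewrite rminE (bigD1 (nseq_tuple k i0)) //= ltr_wpDr //.
  by apply: sumr_ge0 => s _; apply: ltW.
have rmax_gt0 := lt_trans rmin_gt0 rltR.
have upper i : lam * y i ^+ k <= (\sum_s a i s) * P - kap * (P - Q).
  rewrite -yP; apply: le_trans (row_form_le_max i q y_in) _.
  by rewrite lerB // ler_wpM2r // subr_ge0.
have lower i : (\sum_s a i s) * Q + kap * (P - Q) <= lam * y i ^+ k.
  rewrite -yP; apply: le_trans (row_form_ge_min i p (y_ge0 q) yq).
  by rewrite lerD // ler_wpM2r // subr_ge0.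
(* Positivity of [lam] allows [y i ^+ k] to be replaced by [Q] or [P] in the rows [imin] and [imax]
   below. *)
have lam_gt0 : 0 < lam.
  rewrite -(pmulr_lgt0 _ P_gt0) (lt_le_trans _ (lower p)) //.
  rewrite ltr_pwDl ?mulr_ge0 ?subr_ge0 // ?(ltW kap_gt0) //.
  by rewrite mulr_gt0 // (lt_le_trans rmin_gt0) //; case/andP: (r_bounds p).
have lamP : lam * P <= rmax * P - kap * (P - Q).
  apply: le_trans (upper p) _; rewrite lerB // ler_pM2r //.
  by case/andP: (r_bounds p).
have lamQ : rmin * Q + kap * (P - Q) <= lam * Q.
  apply: le_trans (lower q); rewrite lerD // ler_pM2r //.
  by case/andP: (r_bounds q).
have lamQ_le : lam * Q <= rmin * P - kap * (P - Q).
  rewrite rminE; apply: le_trans (upper imin).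
  by rewrite ler_pM2l // lerXn2r ?nnegrE.
have lamP_ge : rmax * Q <= lam * P.
  have : rmax * Q <= lam * y imax ^+ k.
    rewrite rmaxE; apply: le_trans (lower imax).
    by rewrite lerDl mulr_ge0 ?subr_ge0 // ltW.
  move/le_trans; apply.
  by rewrite ler_pM2l // lerXn2r ?nnegrE.
(* Multiply [lamP_ge] by [Q] and [lamQ_le] by [P], then chain the two through [lam * P * Q]; the
   remaining [kap] term makes the later inequality strict. *)
have le_PQ : rmax * Q ^+ 2 <= rmin * P ^+ 2 - kap * P * (P - Q).
  have : rmax * Q * Q <= lam * P * Q by rewrite ler_pM2r.
  have : lam * Q * P <= (rmin * P - kap * (P - Q)) * P by rewrite ler_pM2r.
  by nra.
(* If [Q = P], then [le_PQ] would contradict [rmin < rmax]. *)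
have Q_lt_P : Q < P.
  rewrite lt_neqAle QP andbT; apply: contraTneq le_PQ => ->.
  rewrite subrr mulr0 subr0 -ltNge ltr_pM2r //; exact: exprn_gt0.
have lt_PQ : rmax * Q ^+ 2 < rmin * P ^+ 2.
  by apply: le_lt_trans le_PQ _; rewrite gtrBl !mulr_gt0 // subr_gt0.
have tau_lt : Q / P < Num.sqrt (rmin / rmax).
  rewrite -[ltLHS]ger0_norm ?divr_ge0 ?(ltW P_gt0) ?(ltW Q_gt0) //.
  rewrite -sqrtr_sqr ltr_sqrt ?divr_gt0 // expr_div_n.
  by rewrite ltr_pdivrMr ?exprn_gt0 // mulrAC ltr_pdivlMr // mulrC.
have tau_gt : Num.sqrt (rmax / rmin) < P / Q.
  rewrite -[ltRHS]ger0_norm ?divr_ge0 ?(ltW P_gt0) ?(ltW Q_gt0) //.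
  rewrite -sqrtr_sqr ltr_sqrt ?exprn_gt0 ?divr_gt0 // expr_div_n.
  by rewrite ltr_pdivrMr // mulrAC ltr_pdivlMr ?exprn_gt0 // [ltRHS]mulrC.
(* Dividing [lamQ] by [Q] and [lamP] by [P] gives bounds in [P / Q] and [Q / P]; the square roots
   are strictly weaker. *)
split.
  apply: (@lt_le_trans _ _ (rmin + kap * (P / Q - 1))).
    by rewrite ltrD2l ltr_pM2l // ltrD2r.
  rewrite -(ler_pM2r Q_gt0); apply: le_trans lamQ.
  by rewrite mulrDl -mulrA mulrBl divfK ?gt_eqF // mul1r.
apply: (@le_lt_trans _ _ (rmax - kap * (1 - Q / P))); last first.
  by rewrite ltrD2l ltrN2 ltr_pM2l // ltrD2l ltrN2.
rewrite -(ler_pM2r P_gt0); apply: (le_trans lamP).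
by rewrite mulrBl -mulrA mulrBl divfK ?gt_eqF // mul1r.
Qed.

End PositiveRowForm.

(** * Application to Cauchy tensors *)

Lemma tensor_apply_row_form (R : realType) (n k : nat) (T : tensor R k.+1 n)
    (x : 'rV[R]_n) (i : 'I_n) :
  tensor_apply T x i =
  row_form (fun i (s : k.-tuple 'I_n) => T [tuple of i :: s]) (x ord0) i.
Proof.
rewrite /tensor_apply /row_form.
rewrite (reindex_onto (fun s : k.-tuple 'I_n => [tuple of i :: s])
  (fun t => [tuple of behead t])) /=; last first.
  by move=> t /eqP; case/tupleP: t => j t [->]; apply: val_inj.
apply: eq_big => [s|s _] //=; rewrite eqxx /=; apply/eqP; exact: val_inj.
Qed.

(** Each term is strictly decreasing in the leading entry. The constant tuple only supplies one
    term, so that the sum is nonempty and the inequality strict. *)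
Lemma Cauchy_row_sum_lt (R : realType) (n m : nat) (c : 'rV[R]_n) (i j : 'I_n) :
  (forall i, 0 < c ord0 i) -> c ord0 i < c ord0 j ->
  Cauchy_row_sum m c j < Cauchy_row_sum m c i.
Proof.
move=> c_gt0 cij.
have sum_ge0 (s : seq 'I_n) : 0 <= index_sum c s.
  by apply: sumr_ge0 => l _; apply: ltW.
have term_lt s : 1 / (c ord0 j + index_sum c s) < 1 / (c ord0 i + index_sum c s).
  by rewrite !div1r ltf_pV2 ?ltrD2r // posrE ltr_wpDr.
rewrite /Cauchy_row_sum (bigD1 (nseq_tuple m.-1 i)) //=.
rewrite [ltRHS](bigD1 (nseq_tuple m.-1 i)) //= ltr_leD //.
by apply: ler_sum => s _; apply: ltW.
Qed.

Theorem theorem3p1 (R : realType) (m n : nat)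
    (m_gt0 : (0 < m)%N) (m_even : ~~ odd m) (n_gt0 : (0 < n)%N)
    (c : 'rV[R]_n) (C : tensor R m n)
    (C_Cauchy : symmetric_Cauchy_tensor c C)
    (c_gt0 : forall i : 'I_n, 0 < c ord0 i)
    (c_nonconst : exists i j : 'I_n, c ord0 i != c ord0 j)
    (lambda_max : R) (lambda_maxP : largest_H_eigenvalue C lambda_max) :
  let abar := max_entry n_gt0 (fun i : 'I_n => c ord0 i) in
  let rmax := max_entry n_gt0 (fun i : 'I_n => Cauchy_row_sum m c i) in
  let rmin := min_entry n_gt0 (fun i : 'I_n => Cauchy_row_sum m c i) in
  rmin + 1 / (m%:R * abar) * (Num.sqrt (rmax / rmin) - 1) < lambda_max /\
  lambda_max < rmax - 1 / (m%:R * abar) * (1 - Num.sqrt (rmin / rmax)).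
Proof.
move=> abar rmax rmin.
case: m m_gt0 m_even C C_Cauchy lambda_maxP @rmax @rmin => // k _ k_odd C.
(* Evenness of m makes [k] odd, hence nonzero. *)
have k_gt0 : (0 < k)%N by case: k k_odd {C}.
case=> _ CE [[x [x_neq0 xP]] lam_max] rmax rmin.
pose a i (s : k.-tuple 'I_n) := C [tuple of i :: s].
have aE i s : a i s = 1 / (c ord0 i + index_sum c s).
  by rewrite /a CE /index_sum big_cons.
have row_sumE i : Cauchy_row_sum k.+1 c i = \sum_s a i s.
  by apply: eq_bigr => s _; rewrite aE.
have sum_gt0 i (s : k.-tuple 'I_n) : 0 < c ord0 i + index_sum c s.
  by rewrite ltr_wpDr //; apply: sumr_ge0 => l _; apply: ltW.
have a_gt0 i s : 0 < a i s by rewrite aE divr_gt0.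
have c_le i : c ord0 i <= abar by exact: le_max_entry.
have abar_gt0 : 0 < abar := lt_le_trans (c_gt0 (Ordinal n_gt0)) (c_le _).
have [y y_gt0 yP] : exists2 y, forall i, 0 < y i &
    forall i, row_form a y i = lambda_max * y i ^+ k.
  apply: largest_eigenvector => // [|mu z [i zi] zP].
    exists (x ord0) => [|i]; first exact/rV0Pn.
    by rewrite -tensor_apply_row_form xP.
  apply: lam_max; exists (\row_j z j); split=> [|j].
    by apply/rV0Pn; exists i; rewrite mxE.
  rewrite tensor_apply_row_form mxE -zP; congr row_form.
  by apply/funext => l; rewrite mxE.
apply: (eigenvalue_bounds a_gt0 n_gt0 y_gt0 yP).
- by rewrite divr_gt0 // mulr_gt0 // ltr0n.
(* Each denominator is a sum of [k.+1] entries of [c], all at most [abar]. *)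
- move=> i s; rewrite aE !div1r lef_pV2 ?posrE ?mulr_gt0 ?ltr0n //.
  rewrite mulrSr mulrDl mul1r addrC lerD // /index_sum.
  apply: le_trans (ler_sum _ (fun l _ => c_le l)) _.
  by rewrite big_const_seq count_predT size_tuple iter_addr_0 mulr_natl.
- by move=> i; rewrite -row_sumE min_entry_le le_max_entry.
- have [i iE] := min_entry_attained n_gt0 (Cauchy_row_sum k.+1 c).
  by exists i; rewrite -row_sumE.
- have [i iE] := max_entry_attained n_gt0 (Cauchy_row_sum k.+1 c).
  by exists i; rewrite -row_sumE.
have [i [j]] := c_nonconst.
suff rmin_lt_rmax i1 i2 : c ord0 i1 < c ord0 i2 -> rmin < rmax.
  by rewrite neq_lt => /orP[]; exact: rmin_lt_rmax.
move=> /(Cauchy_row_sum_lt k.+1 c_gt0) lt_sum.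
apply: le_lt_trans (min_entry_le n_gt0 _ i2) _.
exact: lt_le_trans lt_sum (le_max_entry n_gt0 _ i1).
Qed.
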